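(* Let $Q$ be a groupoid. Then $Q$ is a quadratical quasigroup if and only if $Q$ is medial, idempotent and satisfies property A.
   Context: A groupoid is a nonempty set with a binary operation, written as juxtaposition. A groupoid $G$ is right solvable if for all $a,b\in G$ there is a unique $x\in G$ with $ax=b$. It has property A if $(xy)x=(zx)(yz)$ for all $x,y,z\in G$. A quadratical groupoid (equivalently, quadratical quasigroup) is a right solvable groupoid with property A; such a groupoid is known to be a quasigroup. A groupoid is idempotent if $xx=x$ for all $x$; medial if $(xy)(zw)=(xz)(yw)$ for all $x,y,z,w$. *)

(* Defs.v *)
From mathcomp Require Import all_boot.

Set Implicit Arguments.
Unset Strict Implicit.
Unset Printing Implicit Defensive.

(* A groupoid is a nonempty type carrying an arbitrary binary operation;
   library magmas are not used because their carrier must be a choiceType. *)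
Record groupoid : Type := Groupoid {
  carrier :> Type;
  gop : carrier -> carrier -> carrier;
  carrier_inhabited : inhabited carrier
}.

Declare Scope groupoid_scope.
Delimit Scope groupoid_scope with gpd.
Notation "x ** y" := (gop x y)
  (at level 40, left associativity) : groupoid_scope.
Local Open Scope groupoid_scope.

Definition right_solvable (G : groupoid) : Prop :=
  forall a b : G, exists! x : G, a ** x = b.

Definition propertyA (G : groupoid) : Prop :=
  forall x y z : G, (x ** y) ** x = (z ** x) ** (y ** z).

(* Two-sided solvability is not part of the definition: it is a consequence. *)
Definition quadratical_quasigroup (G : groupoid) : Prop :=
  right_solvable G /\ propertyA G.

Definition idempotent_groupoid (G : groupoid) : Prop :=
  idempotent_op (@gop G).

(* [interchange op op] unfolds to (xy)(zw) = (xz)(yw) for all x, y, z, w. *)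
Definition medial (G : groupoid) : Prop :=
  interchange (@gop G) (@gop G).

(* Main.v *)
Require Import Defs.
From mathcomp Require Import all_boot.

(** The model to keep in mind is the complex plane with
    [x ** y = (1 - q) x + q y], [q = (1 + i) / 2]: then [x ** y] is the centre
    of a square with side [xy], and [(x ** y) ** x] is the midpoint of [x] and
    [y].  Property A says that the midpoint is also [(z ** x) ** (y ** z)] for
    every [z]; once the operation is idempotent, the choice [z := y] makes the
    midpoint symmetric in [x] and [y], and most of the argument exploits this
    symmetry ([midpointC]).

    From right solvability to mediality.  Idempotence is property A with
    [x = y = z] after cancelling on the left.  Symmetry of the midpoint turns
    two right divisions into a left division ([left_solvable]).  Given [z ** w]
    and [x], write [z ** w = z' ** x]; the factors of the two expressions are
    related by [x ** z = w ** z'] ([cross_factors]), and both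
    [(x ** y) ** (z ** w)] and [(x ** z) ** (y ** w)] become the midpoint of [y]
    and [z'].

    From mediality to right solvability.  Two elements [x] and [y] with
    [a ** x = a ** y] coincide because each is recovered as
    [(a ** x) ** (x ** a)].  For existence, the solution of [a ** x = b] in the
    plane is [(1 - i) b + i a]; this point is a value of a term in [a] and [b]
    ([right_quotient]), and since medial idempotent groupoids are distributive
    the equation can be checked by computing with midpoints. *)

Set Implicit Arguments.
Unset Strict Implicit.
Unset Printing Implicit Defensive.

Local Open Scope groupoid_scope.

Section Groupoid.

Context {G : groupoid}.
Implicit Types a b c d u v w x y z : G.

Lemma midpoint_elastic x y :
  idempotent_groupoid G -> propertyA G -> (x ** y) ** x = x ** (y ** x).
Proof. by move=> idG A; rewrite (A x y x) idG. Qed.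

Lemma midpointC x y :
  idempotent_groupoid G -> propertyA G -> (x ** y) ** x = (y ** x) ** y.
Proof. by move=> idG A; rewrite (A x y y) idG. Qed.

(** In the plane: the squares erected on the two sides of the segment [zx]
    have centres [z ** x] and [x ** z]; together with [z] and [x] these centres
    are the vertices of a square with diagonal [zx], so a square with the other
    diagonal as a side can be centred at [x]. *)
Lemma bookend x z :
  idempotent_groupoid G -> propertyA G -> (z ** x) ** (x ** z) = x.
Proof. by move=> idG A; rewrite -(A x x z) !idG. Qed.

Lemma left_cancel a x y : right_solvable G -> a ** x = a ** y -> x = y.
Proof.
move=> solG eq_ax; have [t [_ t_uniq]] := solG a (a ** y).
by rewrite -(t_uniq x eq_ax) -(t_uniq y).
Qed.

Lemma quadratical_idempotent :
  right_solvable G -> propertyA G -> idempotent_groupoid G.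
Proof. by move=> solG A x; apply/esym/(left_cancel solG)/A. Qed.

(** In the plane left division is a composite of two right divisions: if
    [b ** p = a] and [a ** y = p], then [y ** a = b], since
    [p ** a = a ** b] is the symmetry of the midpoint of [p] and [b]. *)
Lemma left_solvable a b :
  right_solvable G -> propertyA G -> exists y, y ** a = b.
Proof.
move=> solG A; have idG := quadratical_idempotent solG A.
have [p [bp _]] := solG b a; have [y [ay _]] := solG a p.
exists y; apply: (left_cancel (a := a) solG).
by rewrite -midpoint_elastic // ay -{1}bp -midpoint_elastic // midpointC // bp.
Qed.

(** Multiplied on the left by the common value of [z' ** x] and [z ** w], the
    two sides give the midpoint of [x] and [w]. *)
Lemma cross_factors x z w z' :
  right_solvable G -> propertyA G -> z' ** x = z ** w -> w ** z' = x ** z.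
Proof.
move=> solG A eq_zw; have idG := quadratical_idempotent solG A.
apply: (left_cancel (a := z ** w) solG).
by rewrite -(A w x z) -eq_zw -(A x w z') midpointC.
Qed.

Lemma quadratical_medial : right_solvable G -> propertyA G -> medial G.
Proof.
move=> solG A x y z w; have idG := quadratical_idempotent solG A.
have [z' eq_zw] := left_solvable x (z ** w) solG A.
by rewrite -(cross_factors solG A eq_zw) -(A z' y w) -eq_zw -(A y z' x) midpointC.
Qed.

Lemma left_distributive_medial x y z :
  medial G -> idempotent_groupoid G -> x ** (y ** z) = (x ** y) ** (x ** z).
Proof. by move=> medG idG; rewrite medG idG. Qed.

Lemma right_distributive_medial x y z :
  medial G -> idempotent_groupoid G -> (x ** y) ** z = (x ** z) ** (y ** z).
Proof. by move=> medG idG; rewrite medG idG. Qed.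

Lemma medial_left_cancel a x y :
  medial G -> idempotent_groupoid G -> propertyA G -> a ** x = a ** y -> x = y.
Proof.
move=> medG idG A eq_ax.
by rewrite -(bookend x a idG A) eq_ax medG eq_ax bookend.
Qed.

(** With [a = 0] and [b = 1] in the plane, the iterated product
    [d = b ** (b ** a)] is [1 - i / 2], and the term below is [1 - i]. *)
Definition right_quotient a b : G :=
  let d := b ** (b ** a) in (b ** d) ** (d ** a).

(** Left distributivity splits [a ** right_quotient a b] as a product of two
    factors, which are [u ** b] and [b ** u] for the midpoint [u] of [a] and
    [a ** b]; their product is [b] by [bookend]. *)
Lemma right_quotientP a b :
  medial G -> idempotent_groupoid G -> propertyA G ->
  a ** right_quotient a b = b.
Proof.
move=> medG idG A; rewrite /right_quotient.
set c := b ** a; set d := b ** c; set e := a ** b; set u := (a ** e) ** a.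
have distl x y z := left_distributive_medial x y z medG idG.
have distr x y z := right_distributive_medial x y z medG idG.
have el x y := midpoint_elastic x y idG A.
have midC x y := midpointC x y idG A.
(* Both sides are the midpoint of [c] and [c ** b], the latter being the
   midpoint of [a] and [b]. *)
have bu : a ** (d ** a) = b ** u.
  have -> : b ** u = (c ** (c ** b)) ** c.
    by rewrite /u distl (distl b a e) /e -(el b a).
  by rewrite -el (A a d b) -/c /d -midC !el.
(* Both sides are the midpoint of [e] and [e ** b]. *)
have ub : a ** (b ** d) = u ** b.
  have be : b ** e = e ** a by rewrite /e -el midC.
  have ad : a ** d = (e ** b) ** e.
    by rewrite el be /d /c distl -el.
  have -> : u ** b = (e ** (e ** b)) ** e.
    by rewrite /u (midC a e) (distr _ e b) (distr e a b) -/e midC.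
  by rewrite distl ad -/e (el e (e ** b)).
by rewrite distl ub bu bookend.
Qed.

Lemma medial_right_solvable :
  medial G -> idempotent_groupoid G -> propertyA G -> right_solvable G.
Proof.
move=> medG idG A a b; exists (right_quotient a b).
split=> [|x ax]; first exact: right_quotientP.
by apply: (medial_left_cancel (a := a)) => //; rewrite ax right_quotientP.
Qed.

End Groupoid.

Theorem corollary2p5 (Q : groupoid) :
  quadratical_quasigroup Q <->
  medial Q /\ idempotent_groupoid Q /\ propertyA Q.
Proof.
split=> [[solQ A] | [medQ [idQ A]]].
  split; first exact: quadratical_medial.
  by split; first exact: quadratical_idempotent.
by split; first exact: medial_right_solvable.
Qed.
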